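(* Let $\Gamma$ be a finite connected graph without loops, with a Hamiltonian $\mathcal H$ and associated Lagrangian $\mathcal L$. Then: (i) the action functional $\mu\mapsto\int\mathcal L\,d\mu$ admits a minimum in $\mathbb M$; (ii) for every $h\in H_1(\Gamma,\mathbb R)$, the action functional admits a minimum in $\rho^{-1}(h)=\{\mu\in\mathbb M:\rho(\mu)=h\}$.
   Context: Graph. $\Gamma=(V,E)$ consists of disjoint finite sets $V$ (vertices) and $E\neq\emptyset$ (directed edges), a map $o:E\to V$ (origin) and a fixed-point-free involution $e\mapsto -e$ of $E$; $t(e):=o(-e)$. A path is a finite sequence of edges $(e_i)_{i=1}^M$ with $t(e_i)=o(e_{i+1})$. $\Gamma$ is connected (any two vertices are linked by a path) and has no loops ($o(e)\ne t(e)$). Homology. $C_0$ is the real vector space with basis $V$; $C_1$ is the real vector space generated by $E$ with the edge $-e$ identified with the opposite of $e$; $\partial e=t(e)-o(e)$; $H_1(\Gamma,\mathbb R)=\ker\partial\subset C_1$. Tangent bundle and measures. $T\Gamma=(E\times[0,+\infty))/\sim$, where $(e,0)\sim(-e,0)$; $\mathbb R^+_e:=\{e\}\times[0,+\infty)$. The metric is $d((e_1,q_1),(e_2,q_2))=q_1+q_2+1$ if $e_1\ne\pm e_2$, $|q_1-q_2|$ if $e_1=e_2$, $q_1+q_2$ if $e_1=-e_2$. $\mathbb P$ is the set of Borel probability measures on $T\Gamma$ with $\int q\,d\mu<+\infty$, with the first Wasserstein distance. For $\mu\in\mathbb P$, $\rho(\mu)=\sum_{e\in E}\big(\int_{\mathbb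 R^+_e}q\,d\mu\big)e\in C_1$. For $f:V\to\mathbb R$, $df(e)=f(t(e))-f(o(e))$ and $\int df\,d\mu:=\sum_e df(e)\int_{\mathbb R_e^+}q\,d\mu$. $\mu$ is closed if $\int df\,d\mu=0$ for all $f:V\to\mathbb R$, equivalently $\rho(\mu)\in H_1(\Gamma,\mathbb R)$ (the rotation vector of $\mu$); $\mathbb M\subset\mathbb P$ is the set of closed measures. Hamiltonian and Lagrangian. A Hamiltonian is a family of functions $\mathcal H(e,\cdot):\mathbb R\to\mathbb R$, $e\in E$, with $\mathcal H(e,p)=\mathcal H(-e,-p)$, each strictly convex, differentiable and superlinear ($\mathcal H(e,p)/|p|\to+\infty$ as $p\to\pm\infty$). The Lagrangian is $\mathcal L(e,q)=\max_{p\in\mathbb R}(pq-\mathcal H(e,p))$; since $\mathcal L(e,q)=\mathcal L(-e,-q)$ it is a well-defined function on $T\Gamma$. *)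

(* Defs.v *)
From HB Require Import structures.
From mathcomp Require Import all_boot all_order all_algebra.
From mathcomp Require Import generic_quotient ring_quotient interval_inference.
From mathcomp Require Import all_classical all_reals all_analysis.
From mathcomp Require Import lra.

Set Implicit Arguments.
Unset Strict Implicit.
Unset Printing Implicit Defensive.

Import Order.TTheory GRing.Theory Num.Theory.
Import numFieldNormedType.Exports.

Local Open Scope classical_set_scope.
Local Open Scope quotient_scope.
Local Open Scope ring_scope.

Record graph := Graph {
  vertex : finType;
  edge : finType;
  orig : edge -> vertex;
  opp : edge -> edge;
  opp_involutive : involutive opp;
  opp_neq : forall e, opp e != e;
  edge_nonempty : (0 < #|edge|)%N
}.

Definition term (G : graph) (e : edge G) : vertex G := orig (opp e).

Definition loopless (G : graph) := forall e : edge G, orig e <> term e.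

Definition adjacent (G : graph) : rel (edge G) :=
  [rel e e' | term e == orig e'].

(* The path is [e :: es]; paths are nonempty here since [u <> v]. *)
Definition connected_graph (G : graph) :=
  forall u v : vertex G, u <> v ->
    exists (e : edge G) (es : seq (edge G)),
      [/\ path (@adjacent G) e es, orig e = u & term (last e es) = v].

Section homology.
Variables (R : realType) (G : graph).

Local Notation chain0 := {ffun vertex G -> R^o}.
Local Notation prechain1 := {ffun edge G -> R^o}.

Definition delta0 (v : vertex G) : chain0 := [ffun w => (w == v)%:R].
Definition delta1 (e : edge G) : prechain1 := [ffun e' => (e' == e)%:R].

(* [chain1] is the space freely generated by the edges, modulo the relations
   identifying [opp e] with the opposite of [e]. *)
Definition edge_relations : {vspace prechain1} :=
  span [seq delta1 e + delta1 (opp e) | e <- enum (edge G)].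

Definition chain1 : Type := Quotient.quot edge_relations.
HB.instance Definition _ := GRing.Zmodule.on chain1.
HB.instance Definition _ := EqQuotient.on chain1.

Lemma chain1_eqP (x y : prechain1) :
  \pi_chain1 x = \pi_chain1 y <-> x - y \in edge_relations.
Proof. by rewrite Quotient.idealrBE; split=> /eqP. Qed.

Lemma pi_chain1D (x y : prechain1) :
  \pi_chain1 (x + y) = \pi_chain1 x + \pi_chain1 y.
Proof. exact: pi_addr. Qed.

Definition chain1_scale (a : R) (x : chain1) : chain1 :=
  \pi_chain1 (a *: repr x).

Lemma pi_chain1Z (a : R) (x : prechain1) :
  \pi_chain1 (a *: x) = chain1_scale a (\pi_chain1 x).
Proof.
apply/chain1_eqP; rewrite -scalerBr memvZ //.
by apply/chain1_eqP; rewrite reprK.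
Qed.

Let chain1_scaleA (a b : R) (x : chain1) :
  chain1_scale a (chain1_scale b x) = chain1_scale (a * b) x.
Proof. by elim/quotW: x => x; rewrite -(pi_chain1Z b) -!pi_chain1Z scalerA. Qed.

Let chain1_scale1 : left_id (1 : R) chain1_scale.
Proof. by elim/quotW=> x; rewrite -pi_chain1Z scale1r. Qed.

Let chain1_scaleDr : right_distributive chain1_scale +%R.
Proof.
move=> a; elim/quotW=> x; elim/quotW=> y.
by rewrite -pi_chain1D -!pi_chain1Z scalerDr pi_chain1D.
Qed.

Let chain1_scaleDl (x : chain1) :
  {morph (fun a => chain1_scale a x) : a b / a + b}.
Proof.
by move=> a b; elim/quotW: x => x; rewrite -!pi_chain1Z scalerDl pi_chain1D.
Qed.

HB.instance Definition _ := GRing.Zmodule_isLmodule.Build R chain1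
  chain1_scaleA chain1_scale1 chain1_scaleDr chain1_scaleDl.

Definition chain1_of_edge (e : edge G) : chain1 := \pi_chain1 (delta1 e).

Definition preboundary (x : prechain1) : chain0 :=
  \sum_e x e *: (delta0 (term e) - delta0 (orig e)).

Definition boundary (x : chain1) : chain0 := preboundary (repr x).

Lemma preboundary_linear : linear preboundary.
Proof.
move=> a x y; rewrite /preboundary scaler_sumr -big_split /=.
by apply: eq_bigr => e _; rewrite !ffunE scalerDl scalerA.
Qed.

HB.instance Definition _ :=
  GRing.isLinear.Build R prechain1 chain0 *:%R preboundary preboundary_linear.

Lemma preboundary_delta1 (e : edge G) :
  preboundary (delta1 e) = delta0 (term e) - delta0 (orig e).
Proof.
rewrite /preboundary (bigD1 e) //= ffunE eqxx scale1r big1 ?addr0 // => e' ne.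
by rewrite ffunE (negbTE ne) scale0r.
Qed.

Lemma preboundary_relations (x : prechain1) :
  x \in edge_relations -> preboundary x = 0.
Proof.
suff: (edge_relations <= lker (linfun preboundary))%VS.
  by move=> /subvP h /h; rewrite memv_ker lfunE => /eqP.
apply/span_subvP => _ /mapP[e _ ->]; rewrite memv_ker lfunE /= linearD /=.
by rewrite !preboundary_delta1 /term opp_involutive addrA subrK subrr.
Qed.

Lemma boundary_pi (x : prechain1) : boundary (\pi_chain1 x) = preboundary x.
Proof.
apply/eqP; rewrite -subr_eq0 /boundary -linearB /= preboundary_relations //.
by apply/chain1_eqP; rewrite reprK.
Qed.

Lemma boundary_linear : linear boundary.
Proof.
move=> a; elim/quotW=> x; elim/quotW=> y.
rewrite -[a *: \pi_chain1 _]pi_chain1Z -pi_chain1D !boundary_pi.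
exact: linearP.
Qed.

HB.instance Definition _ :=
  GRing.isLinear.Build R chain1 chain0 *:%R boundary boundary_linear.

Lemma boundary_edge (e : edge G) :
  boundary (chain1_of_edge e) = delta0 (term e) - delta0 (orig e).
Proof. by rewrite /chain1_of_edge boundary_pi preboundary_delta1. Qed.

Lemma chain1_of_opp (e : edge G) : chain1_of_edge (opp e) = - chain1_of_edge e.
Proof.
apply/eqP; rewrite -addr_eq0 -pi_chain1D; apply/eqP.
have <- : \pi_chain1 0 = 0 :> chain1 by exact: pi_zeror.
apply/chain1_eqP; rewrite subr0 addrC memv_span //.
by apply/mapP; exists e; rewrite ?mem_enum.
Qed.

Definition homology1 : set chain1 := [set h | boundary h = 0].

End homology.

Section tangent.
Variables (R : realType) (G : graph).

Local Notation pretangent := (edge G * {nonneg R})%type.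
Implicit Types x y z : pretangent.

Definition tangent_eq : rel pretangent := fun x y =>
  (x == y) || [&& x.2%:num == 0, y.2%:num == 0 & x.1 == opp y.1].

Lemma eq_opp (e e' : edge G) : (e == opp e') = (e' == opp e).
Proof.
by apply/eqP/eqP => [->|->]; rewrite opp_involutive.
Qed.

Lemma tangent_eq_equiv : equiv_class_of tangent_eq.
Proof.
rewrite /tangent_eq; split=> [x|x y|y x z]; first by rewrite eqxx.
  by rewrite eq_sym eq_opp andbCA.
case/orP=> [/eqP->//|/and3P[x0 y0 /eqP xy]].
case/orP=> [/eqP<-|/and3P[_ z0 /eqP yz]]; first by rewrite x0 y0 xy eqxx orbT.
apply/orP; left; apply/eqP; case: x x0 xy => [e p] /= /eqP p0 ->.
case: z z0 yz => [e' p'] /= /eqP p'0 ->; rewrite opp_involutive.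
by congr pair; apply/val_inj; rewrite /= p0 p'0.
Qed.

Canonical tangent_equivRel := EquivRelPack tangent_eq_equiv.
Canonical tangent_encModRel := defaultEncModRel tangent_eq.

Definition tangent : Type := {eq_quot tangent_eq}.
HB.instance Definition _ := Choice.on tangent.
HB.instance Definition _ := EqQuotient.on tangent.

Definition tangent_pt (e : edge G) (q : {nonneg R}) : tangent :=
  \pi_tangent (e, q).

Lemma tangent_eqP x y :
  \pi_tangent x = \pi_tangent y <-> tangent_eq x y.
Proof. by split=> [/eqmodP//|xy]; apply/eqmodP. Qed.

Definition pretangent_dist x y : R :=
  if x.1 == y.1 then `|x.2%:num - y.2%:num|
  else if x.1 == opp y.1 then x.2%:num + y.2%:num
  else x.2%:num + y.2%:num + 1.

Lemma pretangent_dist_sym x y : pretangent_dist x y = pretangent_dist y x.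
Proof.
rewrite /pretangent_dist eq_sym eq_opp distrC.
by rewrite [x.2%:num + _]addrC.
Qed.

Lemma pretangent_dist_triangle y x z :
  pretangent_dist x z <= pretangent_dist x y + pretangent_dist y z.
Proof.
have distP (a b : R) : 0 <= a -> 0 <= b ->
    `|a - b| <= a + b /\ (a - b <= `|a - b| /\ b - a <= `|a - b|).
  move=> a0 b0; split; first by rewrite (le_trans (ler_normB _ _))// !ger0_norm.
  by split; [exact: ler_norm | rewrite distrC; exact: ler_norm].
case: x y z => [e1 p1] [e2 p2] [e3 p3]; rewrite /pretangent_dist /=.
have a1 : 0 <= p1%:num by []. have a2 : 0 <= p2%:num by [].
have a3 : 0 <= p3%:num by [].
have := distP _ _ a1 a2; have := distP _ _ a2 a3; have := distP _ _ a1 a3.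
have := ler_distD p2%:num p1%:num p3%:num.
move: p1%:num p2%:num p3%:num a1 a2 a3 => q1 q2 q3 a1 a2 a3.
move: `|q1 - q2| `|q2 - q3| `|q1 - q3| => d12 d23 d13.
move=> tri [u1 [v1 w1]] [u2 [v2 w2]] [u3 [v3 w3]].
case: (eqVneq e1 e2) => [->|n12].
  by case: (eqVneq e2 e3) => [_|_]; [lra|case: eqP => _; lra].
case: (eqVneq e1 (opp e2)) => [->|m12].
  case: (eqVneq (opp e2) e3) => [<-|n23].
    by rewrite ?opp_involutive ?eqxx (eq_sym e2) (negbTE (opp_neq _)); lra.
  rewrite (inj_eq (can_inj (@opp_involutive G))).
  rewrite [e2 == opp e3]eq_opp [e3 == _]eq_sym (negbTE n23).
  by case: (eqVneq e2 e3) => _; lra.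
case: (eqVneq e2 e3) => [<-|n23].
  by rewrite (negbTE n12) (negbTE m12); lra.
case: (eqVneq e2 (opp e3)) => [e23|m23]; last first.
  by case: eqP => _; [lra|case: eqP => _; lra].
have -> : opp e3 = e2 by [].
have e32 : e3 = opp e2 by rewrite e23 opp_involutive.
by rewrite e32 (negbTE m12) (negbTE n12); lra.
Qed.

Lemma pretangent_dist_eq0 x y : pretangent_dist x y = 0 <-> tangent_eq x y.
Proof.
case: x y => [e p] [e' p']; rewrite /pretangent_dist /tangent_eq /=.
have p0 : 0 <= p%:num by []. have p0' : 0 <= p'%:num by [].
case: eqVneq => [->|ne].
  split=> [/eqP|/orP[/eqP[->]|/and3P[_ _]]]; last 2 first.
  - by rewrite subrr normr0.
  - by rewrite eq_sym (negbTE (opp_neq _)).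
  by rewrite normr_eq0 subr_eq0 => /eqP pp'; rewrite (val_inj pp') eqxx.
rewrite xpair_eqE (negbTE ne) /=; case: (e == opp e').
  rewrite andbT; split=> [pp'|/andP[/eqP-> /eqP->]]; last by rewrite addr0.
  by apply/andP; split; apply/eqP; lra.
by rewrite !andbF; split => // pp'; exfalso; lra.
Qed.

Definition tangent_dist (u v : tangent) : R := pretangent_dist (repr u) (repr v).

Lemma tangent_dist_pi x y :
  tangent_dist (\pi_tangent x) (\pi_tangent y) = pretangent_dist x y.
Proof.
have d0 z : pretangent_dist (repr (\pi_tangent z)) z = 0.
  by apply/pretangent_dist_eq0/tangent_eqP; rewrite reprK.
rewrite /tangent_dist; set x' := repr _; set y' := repr _.
apply/le_anti/andP; split.
  apply: (le_trans (pretangent_dist_triangle x _ _)); rewrite d0 add0r.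
  apply: (le_trans (pretangent_dist_triangle y _ _)).
  by rewrite [pretangent_dist y _]pretangent_dist_sym d0 addr0.
apply: (le_trans (pretangent_dist_triangle x' _ _)).
rewrite pretangent_dist_sym d0 add0r.
by apply: (le_trans (pretangent_dist_triangle y' _ _)); rewrite d0 addr0.
Qed.

Let tangent_distxx u : tangent_dist u u = 0.
Proof. by apply/pretangent_dist_eq0/tangent_eqP. Qed.

Let tangent_dist_positivity u v : tangent_dist u v = 0 -> u = v.
Proof. by move/pretangent_dist_eq0/tangent_eqP; rewrite !reprK. Qed.

Let tangent_dist_sym u v : tangent_dist u v = tangent_dist v u.
Proof. exact: pretangent_dist_sym. Qed.

Let tangent_dist_triangle v u w :
  tangent_dist u w <= tangent_dist u v + tangent_dist v w.
Proof. exact: pretangent_dist_triangle. Qed.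

HB.instance Definition _ := @isMetric.Build R tangent tangent_dist
  tangent_distxx tangent_dist_positivity tangent_dist_sym
  tangent_dist_triangle.

Let some_edge : edge G := enum_val (Ordinal (edge_nonempty G)).

HB.instance Definition _ := isPointed.Build tangent (tangent_pt some_edge 0%:nng).

Definition borel_tangent := g_sigma_algebraType (@open tangent).

Definition ray (e : edge G) : set tangent := range (tangent_pt e).

Definition speed (u : tangent) : R := (repr u).2%:num.

Lemma speed_pt e q : speed (tangent_pt e q) = q%:num.
Proof.
have /tangent_eqP : \pi_tangent (repr (tangent_pt e q)) = \pi_tangent (e, q).
  by rewrite reprK.
by rewrite /speed => /orP[/eqP->|/and3P[/eqP-> /eqP-> _]].
Qed.

End tangent.

Section measures.
Variables (R : realType) (G : graph).

Definition tangent_measure := probability (borel_tangent R G) R.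

Definition finite_first_moment : set tangent_measure :=
  [set mu : tangent_measure | (\int[mu]_u (speed u)%:E < +oo)%E].

Definition ray_moment (mu : tangent_measure) (e : edge G) : R :=
  \int[mu]_(u in ray e) speed u.

Definition rotation (mu : tangent_measure) : chain1 R G :=
  \sum_e ray_moment mu e *: chain1_of_edge R e.

Definition differential (f : vertex G -> R) (e : edge G) : R :=
  f (term e) - f (orig e).

Definition closed_measures : set tangent_measure :=
  finite_first_moment `&`
  [set mu : tangent_measure | forall f, \sum_e differential f e * ray_moment mu e = 0].

Lemma boundary_rotation (mu : tangent_measure) (f : vertex G -> R) :
  \sum_v f v * boundary (rotation mu) v =
  \sum_e differential f e * ray_moment mu e.
Proof.
have -> : boundary (rotation mu) =
    \sum_e ray_moment mu e *: (delta0 R (term e) - delta0 R (orig e)).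
  rewrite linear_sum; apply: eq_bigr => e _.
  by rewrite linearZ /= boundary_edge.
under eq_bigr do rewrite sum_ffunE mulr_sumr.
rewrite exchange_big /=; apply: eq_bigr => e _.
under eq_bigr do rewrite !ffunE /= mulrCA mulrBr.
rewrite -mulr_sumr mulrC sumrB.
have sumE w : \sum_v f v * (v == w)%:R = f w.
  rewrite (bigD1 w) //= eqxx mulr1 big1 ?addr0 // => v /negbTE ->.
  by rewrite mulr0.
by rewrite !sumE.
Qed.

Lemma closed_measuresE :
  closed_measures = finite_first_moment `&` rotation @^-1` @homology1 R G.
Proof.
congr setI; apply/seteqP; split=> mu /= h; last first.
  by move=> f; rewrite -boundary_rotation h big1 // => v _; rewrite ffunE mulr0.
apply/ffunP => w; rewrite [RHS]ffunE.
have := h (fun v => (v == w)%:R); rewrite -boundary_rotation (bigD1 w) //=.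
by rewrite eqxx mul1r big1 ?addr0 // => v /negbTE ->; rewrite mul0r.
Qed.

End measures.

Section lagrangian.
Variables (R : realType) (G : graph).

Record is_hamiltonian (H : edge G -> R -> R) : Prop := IsHamiltonian {
  hamiltonian_sym : forall e p, H e p = H (opp e) (- p);
  hamiltonian_strictly_convex : forall e p p' t, p != p' -> 0 < t < 1 ->
    H e (t * p + (1 - t) * p') < t * H e p + (1 - t) * H e p';
  hamiltonian_derivable : forall e p, derivable (H e) p 1;
  hamiltonian_superlinear_pinfty : forall e,
    H e p / `|p| @[p --> +oo%R] --> +oo%R;
  hamiltonian_superlinear_ninfty : forall e,
    H e p / `|p| @[p --> -oo%R] --> +oo%R
}.

(* The supremum is attained: see [lagrangian_max]. *)
Definition lagrangian (H : edge G -> R -> R) (e : edge G) (q : R) : R :=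
  sup (range (fun p => p * q - H e p)).

Lemma lagrangian_max H e q : is_hamiltonian H ->
  exists2 p, lagrangian H e q = p * q - H e p &
    forall p', p' * q - H e p' <= lagrangian H e q.
Proof.
move=> hH; pose g p := p * q - H e p.
have [p pmax] : exists p, forall p', g p' <= g p.
  pose K := `|q| + `|H e 0| + 1.
  have K0 : 0 < K by rewrite /K ltr_wpDl // addr_ge0.
  have out p : 1 <= `|p| -> K <= H e p / `|p| -> g p <= g 0.
    move=> p1; rewrite ler_pdivlMr ?(lt_le_trans _ p1)// /g mul0r sub0r => Hp.
    rewrite lerBlDr (le_trans (ler_norm _))// normrM.
    have : - `|H e 0| <= - H e 0 by rewrite lerN2 ler_norm.
    have : `|H e 0| <= `|H e 0| * `|p| by rewrite ler_peMr.
    by rewrite /K in Hp; nra.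
  have /cvgryPge/(_ K) := hamiltonian_superlinear_pinfty hH e.
  move=> [A [_ hA]].
  have /cvgryPge/(_ K) := hamiltonian_superlinear_ninfty hH e.
  move=> [B [_ hB]].
  pose M := `|A| + `|B| + 1.
  have M0 : 1 <= M by rewrite /M lerDr addr_ge0.
  have gc : {within `[- M, M], continuous g}.
    apply: continuous_subspaceT => x.
    apply: cvgB; first exact: mulrr_continuous.
    apply/differentiable_continuous/derivable1_diffP.
    exact: hamiltonian_derivable hH e x.
  have NMM : - M <= M by lra.
  have [c _ cmax] := EVT_max NMM gc.
  exists c => p'.
  have g0c : g 0 <= g c by apply: cmax; rewrite in_itv /=; lra.
  have [p'M|p'M] := leP `|p'| M.
    by apply: cmax; rewrite in_itv /= -ler_norml.
  apply: (le_trans _ g0c); apply: out; first by lra.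
  have := ler_norm A; have := ler_norm (- B); rewrite normrN.
  have [p'0|p'0] := leP 0 p'.
    move=> _ ?; apply: hA; move: p'M; rewrite ger0_norm // /M.
    by have := normr_ge0 B; lra.
  move=> ? _; apply: hB; move: p'M; rewrite ltr0_norm // /M.
  by have := normr_ge0 A; lra.
have supE : lagrangian H e q = g p.
  apply/le_anti/andP; split.
    apply: ge_sup; first by exists (g 0); exists 0.
    by move=> _ [p' _ <-]; exact: pmax.
  apply: ub_le_sup; last by exists p.
  by exists (g p) => _ [p' _ <-]; exact: pmax.
by exists p => //; rewrite supE.
Qed.

Lemma lagrangian_opp H e q : is_hamiltonian H ->
  lagrangian H (opp e) (- q) = lagrangian H e q.
Proof.
move=> hH; congr sup; apply/seteqP; split=> _ [p _ <-]; exists (- p) => //=.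
  by rewrite (hamiltonian_sym hH) opprK mulNr mulrN.
by rewrite mulrNN -(hamiltonian_sym hH).
Qed.

Definition tangent_lagrangian (H : edge G -> R -> R) (u : tangent R G) : R :=
  lagrangian H (repr u).1 (speed u).

Lemma tangent_lagrangian_pt H e q : is_hamiltonian H ->
  tangent_lagrangian H (tangent_pt e q) = lagrangian H e q%:num.
Proof.
move=> hH; rewrite /tangent_lagrangian speed_pt.
have /tangent_eqP : \pi_(tangent R G) (repr (tangent_pt e q)) =
    \pi_(tangent R G) (e, q) by rewrite reprK.
move=> /orP[/eqP->//|/and3P[_ /= /eqP-> /eqP->]].
by rewrite -[in LHS]oppr0 lagrangian_opp.
Qed.

Definition action (H : edge G -> R -> R) (mu : tangent_measure R G) : \bar R :=
  (\int[mu]_u (tangent_lagrangian H u)%:E)%E.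

End lagrangian.

Definition admits_min (T : Type) (R : realType) (F : T -> \bar R) (A : set T) :=
  exists2 x, A x & forall y, A y -> (F x <= F y)%E.

(* Main.v *)
Require Import Defs.
From HB Require Import structures.
From mathcomp Require Import all_boot all_order all_algebra.
From mathcomp Require Import generic_quotient interval_inference.
From mathcomp Require Import all_classical all_reals all_analysis.
From mathcomp Require Import measurable_realfun lra.

(** The action is minimised among atomic measures carrying one atom per edge.
    A closed measure [mu] gives every edge [e] a mass [w e] and a moment [m e],
    and integrating the Young inequality [p * q - H e p <= L e q] gives
    [\sum_e (P e * m e - H e (P e) * w e) <= action H mu] for every choice
    [P] of a slope on each edge.  The triples [(w, m, a)] satisfying all these
    inequalities with [a] in place of the action form a closed set, whose
    sublevels in [a] are bounded by the inequalities for the constant slopes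
    [0] and [1]; so [a] has a minimum on it.  Conversely such a triple is
    realised by atoms of mass [w e] at speed [m e / w e], with action at most
    [a].  Both parts of the theorem constrain the moments by linear equations,
    which keeps the set closed. *)

Set Implicit Arguments.
Unset Strict Implicit.
Unset Printing Implicit Defensive.

Import Order.TTheory GRing.Theory Num.Theory.
Import numFieldNormedType.Exports.

Local Open Scope classical_set_scope.
Local Open Scope quotient_scope.
Local Open Scope ring_scope.

(** * Borel structure of the tangent bundle *)

Section tangent_measurability.
Variables (R : realType) (G : graph).
Implicit Types (u v : tangent R G) (e : edge G).

(* At zero speed, where [e] and [opp e] are identified, this is an arbitrary
   one of the two. *)
Definition dir u : edge G := (repr u).1.

Lemma tangent_ptE u : u = tangent_pt (dir u) (repr u).2.
Proof. by rewrite /tangent_pt /dir -surjective_pairing reprK. Qed.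

Lemma speed_ge0 u : 0 <= speed u.
Proof. by rewrite /speed. Qed.

Lemma ballE u (r : R) v : ball u r v = (tangent_dist u v < r).
Proof. by rewrite ballEmdist. Qed.

Lemma tangent_openP (A : set (tangent R G)) :
  (forall u, A u -> exists2 r : R, 0 < r &
    forall v, tangent_dist u v < r -> A v) -> open A.
Proof.
move=> hA; rewrite openE => u /hA[r r0 ur]; apply/nbhs_ballP.
by exists r => //= v; rewrite ballE; exact: ur.
Qed.

Lemma measurable_open (A : set (tangent R G)) :
  open A -> measurable (A : set (borel_tangent R G)).
Proof. by move=> oA; exact: sub_sigma_algebra. Qed.

(** The set is the singleton of the rest point when [repr] chose [e] there, and empty otherwise; a
    singleton is closed in a metric space. *)
Lemma measurable_at_rest e :
  measurable ([set u | dir u = e /\ speed u = 0] : set (borel_tangent R G)).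
Proof.
pose u0 := tangent_pt e (NngNum (lexx (0 : R))).
have sub1 u : dir u = e -> speed u = 0 -> u = u0.
  move=> ue u1; rewrite (tangent_ptE u) ue /u0; congr tangent_pt.
  exact/val_inj.
have [de|de] := eqVneq (dir u0) e; last first.
  rewrite (_ : [set _ | _] = set0) ?measurable0// -subset0 => u [/[dup] ue].
  by move=> /sub1 /[apply] uu0; rewrite -uu0 ue eqxx in de.
rewrite (_ : [set _ | _] = [set u0]); last first.
  apply/seteqP; split=> [u [ue u1]|_ ->] /=; first exact: sub1.
  by split; rewrite // speed_pt.
rewrite -(setCK [set u0]); apply: measurableC; apply: measurable_open.
rewrite openC; apply: accessible_closed_set1; apply: hausdorff_accessible.
exact: metric_hausdorff.
Qed.

(** The set is open: a point with another direction is at distance at least [speed u] from [u]. *)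
Lemma measurable_moving e :
  measurable ([set u | dir u = e /\ 0 < speed u] : set (borel_tangent R G)).
Proof.
apply: measurable_open; apply: tangent_openP => u [ue u0]; exists (speed u) => // v.
move: (speed_ge0 v); rewrite /tangent_dist /pretangent_dist -/(speed u) -/(speed v).
case: eqP => [uv|_] v0.
  by rewrite ltr_norml -ue /dir uv /= => ?; split=> //; lra.
by case: eqP => _; lra.
Qed.

Lemma measurable_dir e :
  measurable ([set u | dir u = e] : set (borel_tangent R G)).
Proof.
rewrite (_ : [set _ | _] = [set u | dir u = e /\ 0 < speed u] `|`
  [set u | dir u = e /\ speed u = 0]).
  by apply: measurableU; [exact: measurable_moving|exact: measurable_at_rest].
apply/seteqP; split=> [u /= ue|u /= [|] []//].
by have := speed_ge0 u; rewrite le_eqVlt => /orP[/eqP|]; [right|left].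
Qed.

Lemma measurable_fun_gt (f : tangent R G -> R) :
  (forall a, measurable ([set u | a < f u] : set (borel_tangent R G))) ->
  measurable_fun [set: borel_tangent R G] f.
Proof.
move=> hf; apply: (measurability _ (RGenOInfty.measurableE R)).
move=> /= _ [_ [a ->]] <-; apply: measurableI => //.
by rewrite preimage_itvoy; exact: hf.
Qed.

Lemma measurable_speed : measurable_fun [set: borel_tangent R G] (@speed R G).
Proof.
apply: measurable_fun_gt => a; apply: measurable_open; apply: tangent_openP => u ua.
exists (speed u - a) => [|v]; first by rewrite subr_gt0.
rewrite /tangent_dist /pretangent_dist -/(speed u) -/(speed v) /=.
have := speed_ge0 v; rewrite /= in ua *.
case: eqP => _; first by rewrite ltr_norml; lra.
by case: eqP => _; lra.
Qed.

Lemma tangent_lagrangian_ge (H : edge G -> R -> R) u p : is_hamiltonian H ->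
  p * speed u - H (dir u) p <= tangent_lagrangian H u.
Proof. by move=> hH; have [q _] := lagrangian_max (dir u) (speed u) hH; exact. Qed.

Lemma measurable_lagrangian (H : edge G -> R -> R) : is_hamiltonian H ->
  measurable_fun [set: borel_tangent R G] (tangent_lagrangian H).
Proof.
move=> hH; apply: measurable_fun_gt => a.
pose O e := [set q : R | a < lagrangian H e q].
have mO e : measurable (O e).
  (* The Lagrangian is an attained supremum of affine functions of the speed, so its superlevel set
     is the union of theirs. *)
  apply: open_measurable; rewrite (_ : O e =
    \bigcup_p [set q | a + H e p < p * q]).
    apply: bigcup_open => p _.
    apply: (@open_comp _ _ ( *%R p) [set x | a + H e p < x]) => [x _|].
      exact: mulrl_continuous.
    exact: open_gt.
  apply/seteqP; split=> [q|q [p _]]; rewrite /O /=.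
    by have [p -> _] := lagrangian_max e q hH; exists p => //=; lra.
  by have [_ _ /(_ p)] := lagrangian_max e q hH; lra.
rewrite (_ : [set _ | _] =
  \bigcup_e ([set u | dir u = e] `&` (@speed R G @^-1` O e))).
  apply: fin_bigcup_measurable => // e _; apply: measurableI.
    exact: measurable_dir.
  by rewrite -[_ @^-1` _]setTI; exact: measurable_speed.
by apply/seteqP; split=> [u ?|u [_ _ [<-]]//]; exists (dir u).
Qed.

End tangent_measurability.

(** * Edge masses and moments *)

(* No integrability is needed: the positive and negative parts are compared
   separately. *)
Lemma le_integral_measurable (d : measure_display) (T : measurableType d)
    (R : realType) (mu : {measure set T -> \bar R}) (f g : T -> \bar R) :
  measurable_fun setT f -> measurable_fun setT g ->
  (forall x, (f x <= g x)%E) -> (\int[mu]_x f x <= \int[mu]_x g x)%E.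
Proof.
move=> mf mg fg; rewrite integralE [leRHS]integralE; apply: leeB.
  apply: ge0_le_integral => //; do ?exact: measurable_funepos.
  by move=> x _; apply: (@funepos_le _ _ setT) => //; rewrite inE.
apply: ge0_le_integral => //; do ?exact: measurable_funeneg.
by move=> x _; apply: (@funeneg_le _ _ setT) => //; rewrite inE.
Qed.

Section edge_decomposition.
Variables (R : realType) (G : graph) (mu : tangent_measure R G).
Local Notation T := (borel_tangent R G).

Definition edge_mass e : R := fine (mu [set u | dir u = e]).

(* The two sets differ by at most the point of zero speed. *)
Lemma ray_momentE e :
  ray_moment mu e = \int[mu]_(u in [set u | dir u = e]) speed u.
Proof.
rewrite /ray_moment Rintegral_mkcond [RHS]Rintegral_mkcond; congr fine.
apply: eq_integral => u _; congr EFin; rewrite !patchE.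
have [/set_mem[q _ uq]|/negP u1] := boolP (u \in ray e); last first.
  case: ifPn => // /set_mem ue; case: u1; apply: mem_set.
  by exists (repr u).2 => //; rewrite -ue -tangent_ptE.
case: ifPn => // /negP u1; rewrite -uq speed_pt.
have : tangent_pt (dir u) (repr u).2 = tangent_pt e q by rewrite -tangent_ptE.
move=> /tangent_eqP/orP[/eqP[ue _]|/and3P[_ /eqP//]].
by case: u1; exact/mem_set.
Qed.

Hypothesis mu_fin : finite_first_moment mu.

Lemma integrable_speed : mu.-integrable [set: T] (EFin \o @speed R G).
Proof.
apply/integrableP; split.
  by apply/measurable_EFinP; exact: measurable_speed.
by under eq_integral do rewrite /= ger0_norm ?speed_ge0//.
Qed.

Lemma integrable_edge (a b : R) e :
  mu.-integrable [set u : T | dir u = e]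
    (fun u => a%:E * (speed u)%:E + (cst b u)%:E)%E.
Proof.
have me := @measurable_dir R G e.
apply: integrableD => //; last exact: finite_measure_integrable_cst.
by apply: integrableZl => //; apply: integrableS integrable_speed.
Qed.

(** The fibres of [dir] partition the bundle, so measurability and integrals can be treated one edge
    at a time. *)
Lemma edgewiseE (a b : edge G -> R) (u : T) :
  (a (dir u) * speed u + b (dir u))%:E =
  (\sum_(e <- enum (edge G)) ((fun v => (a e)%:E * (speed v)%:E + (cst (b e) v)%:E)
    \_ [set v | dir v = e]) u)%E.
Proof.
rewrite big_enum /= (bigD1 (dir u)) //= big1 ?adde0 => [|e /eqP ne].
  by rewrite patchE mem_set.
by rewrite patchE memNset //= => /esym.
Qed.

Lemma measurable_edgewise (a b : edge G -> R) :
  measurable_fun [set: T] (fun u => (a (dir u) * speed u + b (dir u))%:E).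
Proof.
under eq_fun do rewrite edgewiseE.
apply: emeasurable_sum => e.
have me := @measurable_dir R G e.
apply/(measurable_restrictT _ me).
exact: measurable_int (integrable_edge _ _ _).
Qed.

Lemma integral_edgewise (a b : edge G -> R) :
  (\int[mu]_u (a (dir u) * speed u + b (dir u))%:E)%E =
  (\sum_e (a e * ray_moment mu e + b e * edge_mass e))%:E.
Proof.
under eq_integral do rewrite edgewiseE.
rewrite integral_sum // => [|e]; last first.
  apply: (integrable_mkcond _ (@measurable_dir R G e)).1.
  exact: integrable_edge.
rewrite big_enum /= -sumEFin; apply: eq_bigr => e _.
have me := @measurable_dir R G e.
have i1 : mu.-integrable [set u : T | dir u = e] (EFin \o @speed R G).
  exact: integrableS integrable_speed.
rewrite -integral_mkcond integralD //.
- rewrite integralZl // integral_cst // ray_momentE /edge_mass EFinD !EFinM.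
  rewrite !fineK //; first exact: fin_num_measure.
  exact: integrable_fin_num.
- exact: integrableZl.
- exact: finite_measure_integrable_cst.
Qed.

Lemma edge_mass_ge0 e : 0 <= edge_mass e.
Proof. by rewrite fine_ge0. Qed.

Lemma ray_moment_ge0 e : 0 <= ray_moment mu e.
Proof. by apply: Rintegral_ge0 => u _; exact: speed_ge0. Qed.

Lemma sum_edge_mass : \sum_e edge_mass e = 1.
Proof.
have := integral_edgewise (fun=> 0) (fun=> 1).
under eq_integral do rewrite mul0r add0r.
rewrite integral_cst // mul1e => /(etrans (esym (probability_setT mu)))[->].
by apply: eq_bigr => e _; rewrite mul0r add0r mul1r.
Qed.

Lemma action_ge (H : edge G -> R -> R) (P : edge G -> R) : is_hamiltonian H ->
  ((\sum_e (P e * ray_moment mu e - H e (P e) * edge_mass e))%:E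
    <= action H mu)%E.
Proof.
move=> hH; pose b e := - H e (P e); have := integral_edgewise P b.
under [in X in _ = X]eq_bigr do rewrite mulNr.
move=> <-; apply: le_integral_measurable; first exact: (measurable_edgewise P b).
  by apply/measurable_EFinP; exact: measurable_lagrangian.
by move=> u; rewrite lee_fin; exact: tangent_lagrangian_ge.
Qed.

End edge_decomposition.

(** * Atomic measures *)

Section atomic_measure.
Context (d : measure_display) (T : measurableType d) (R : realType).
Variables (n : nat) (w : nat -> {nonneg R}) (x : nat -> T).

(* The proof argument lets canonical structures find the probability instance. *)
Definition atomic (_ : \sum_(k < n) (w k)%:num = 1) : set T -> \bar R :=
  msum (fun k => mscale (w k) \d_(x k)) n.

Variable w1 : \sum_(k < n) (w k)%:num = 1.

HB.instance Definition _ := Measure.on (atomic w1).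

Lemma atomic_setT : atomic w1 setT = 1%E.
Proof.
rewrite /atomic /msum -[in RHS]w1 -sumEFin; apply: eq_bigr => k _.
by rewrite /= /mscale /= diracT mule1.
Qed.

HB.instance Definition _ :=
  Measure_isProbability.Build d T R (atomic w1) atomic_setT.

Lemma integral_atomic (f : T -> R) : measurable_fun setT f ->
  (\int[atomic w1]_u (f u)%:E = (\sum_(k < n) (w k)%:num * f (x k))%:E)%E.
Proof.
move=> /measurable_EFinP mf.
have ge0E (g : T -> \bar R) : measurable_fun setT g -> (forall u, (0 <= g u)%E) ->
    (\int[atomic w1]_u g u = \sum_(k < n) (w k)%:num%:E * g (x k))%E.
  move=> mg g0; rewrite ge0_integral_measure_sum //; apply: eq_bigr => k _.
  by rewrite ge0_integral_mscale // integral_dirac // diracT mul1e.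
have mp := measurable_funepos mf; have mn := measurable_funeneg mf.
(* Both parts have finite integrals here, so their difference can be taken in [R]. *)
rewrite integralE !ge0E // -sumEFin.
under eq_bigr do rewrite funeposE -EFin_max -EFinM.
under [X in (_ - X)%E]eq_bigr do rewrite funenegE -EFinN -EFin_max -EFinM.
rewrite !sumEFin -EFinB -sumrB; congr EFin; apply: eq_bigr => k _.
by rewrite -mulrBr; congr (_ * _); case: (leP (f (x k)) 0) => ?; case: leP; lra.
Qed.

End atomic_measure.

Section atomic_tangent.
Variables (R : realType) (G : graph).
Local Notation T := (borel_tangent R G).

Lemma dir_pt (e : edge G) (q : {nonneg R}) : 0 < q%:num -> dir (tangent_pt e q) = e.
Proof.
have : tangent_pt (dir (tangent_pt e q)) (repr (tangent_pt e q)).2 = tangent_pt e q.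
  by rewrite -tangent_ptE.
by move=> /tangent_eqP/orP[/eqP[->]//|/and3P[_ /= /eqP -> _]]; rewrite ltxx.
Qed.

Lemma sum_nth_edge (F : edge G -> R) e0 :
  \sum_(k < #|edge G|) F (nth e0 (enum (edge G)) k) = \sum_e F e.
Proof. by rewrite -[RHS]big_enum (big_nth e0) big_mkord cardE. Qed.

Lemma atomic_tangent (H : edge G -> R -> R) (w m : edge G -> R) :
  is_hamiltonian H -> (forall e, 0 <= w e) -> \sum_e w e = 1 ->
  (forall e, 0 <= m e) -> (forall e, w e = 0 -> m e = 0) ->
  exists mu : tangent_measure R G,
    [/\ finite_first_moment mu, forall e, ray_moment mu e = m e &
      action H mu = (\sum_e w e * lagrangian H e (m e / w e))%:E].
Proof.
move=> hH w0 w1 m0 wm.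
have q0 e : 0 <= m e / w e by rewrite divr_ge0.
pose e0 : edge G := enum_val (Ordinal (edge_nonempty G)).
pose ed k := nth e0 (enum (edge G)) k.
pose W k : {nonneg R} := NngNum (w0 (ed k)).
pose x k : T := tangent_pt (ed k) (NngNum (q0 (ed k))).
have W1 : \sum_(k < #|edge G|) (W k)%:num = 1 by rewrite (sum_nth_edge w).
pose mu : tangent_measure R G := @atomic _ T R _ W x W1.
have muE (f : T -> R) : measurable_fun setT f -> (\int[mu]_u (f u)%:E =
    (\sum_e w e * f (tangent_pt e (NngNum (q0 e))))%:E)%E.
  move=> mf; rewrite integral_atomic // -(sum_nth_edge _ e0).
  by [].
(* Massless edges carry an atom at speed [m e / 0 = 0]. *)
exists mu; split.
- by have := ltry (\sum_e w e * speed (tangent_pt e (NngNum (q0 e))));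
    rewrite -(muE _ (@measurable_speed R G)).
(* An atom on [e] may be counted under another direction only when it is at rest, and then it
   contributes no moment. *)
- move=> e; rewrite ray_momentE Rintegral_mkcond.
  have mf : measurable_fun [set: T] (@speed R G \_ [set u | dir u = e]).
    apply/(measurable_restrictT _ (@measurable_dir R G e)).
    exact: measurable_funTS (@measurable_speed R G).
  apply: (etrans (congr1 fine (muE _ mf))); rewrite /= (bigD1 e) //= big1.
    rewrite addr0 patchE speed_pt /=.
    rewrite [X in _ * X](_ : _ = m e / w e).
      have [we0|we0] := eqVneq (w e) 0; first by rewrite we0 mul0r wm.
      by rewrite mulrCA divff ?mulr1.
    case: ifPn => // /negP u1; have := q0 e.
    rewrite le_eqVlt => /orP[/eqP//|mw]; case: u1; apply: mem_set.
    exact: dir_pt.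
  move=> e' ne; rewrite patchE speed_pt /=.
  case: ifPn => [/set_mem /= ue|]; last by rewrite mulr0.
  have := q0 e'; rewrite le_eqVlt => /orP[/eqP<-|]; first by rewrite mulr0.
  by move=> mw; move: ne; rewrite -ue dir_pt ?eqxx.
- apply: (etrans (muE _ (measurable_lagrangian hH))); congr EFin.
  by apply: eq_bigr => e _; rewrite tangent_lagrangian_pt.
Qed.

End atomic_tangent.

(** * The finite-dimensional problem *)

Section finite_dimensional_minimum.
Variables (R : realType) (E : finType) (I : Type).
Variables (h : E -> R -> R) (c : I -> E -> R) (b : I -> R).

(* [a] bounds the action of atoms of mass [w e] and moment [m e]. *)
Definition feasible (w m : E -> R) (a : R) :=
  [/\ forall e, 0 <= w e, \sum_e w e = 1, forall e, 0 <= m e,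
      forall i, \sum_e c i e * m e = b i &
      forall p : E -> R, \sum_e (p e * m e - h e (p e) * w e) <= a].

(** Triples as points of a finite power of [R]: [Some (inl e)] indexes masses, [Some (inr e)]
    moments and [None] the bound [a]. Tychonoff then gives compact boxes. *)
Local Notation X := (prod_topology (fun _ : option (E + E) => R)).

Let continuous_scale (T : topologicalType) (F : T -> R) k :
  continuous F -> continuous (fun f => k * F f).
Proof. by move=> cF f; apply: cvgM; [exact: cvg_cst|exact: cF]. Qed.

Let continuous_sub (T : topologicalType) (F F' : T -> R) :
  continuous F -> continuous F' -> continuous (fun f => F f - F' f).
Proof. by move=> cF cF' f; apply: cvgB; [exact: cF|exact: cF']. Qed.

Let ev i : X -> R := fun f => f i.

Let ev_continuous i : continuous (ev i).
Proof. exact: (@proj_continuous _ (fun _ => R)). Qed.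

Let closed_cst_le (F : X -> R) a : continuous F -> closed [set f | F f <= a].
Proof. by move=> cF; apply: closed_comp (@closed_le _ a) => f _; exact: cF. Qed.

Let closed_cst_eq (F : X -> R) a : continuous F -> closed [set f | F f = a].
Proof. by move=> cF; apply: closed_comp (@closed_eq _ a) => f _; exact: cF. Qed.

Let sum_continuous (F : E -> X -> R) : (forall e, continuous (F e)) ->
  continuous (fun f => \sum_e F e f).
Proof.
move=> cF; apply: (@continuous_big R E +%R 0 xpredT) => [|e _]; last exact: cF.
exact: (@add_continuous R).
Qed.

Let W f e := ev (Some (inl e)) f.
Let M f e := ev (Some (inr e)) f.
Let A f := ev None f.

Let closed_feasible : closed [set f : X | feasible (W f) (M f) (A f)].
Proof.
(* Each constraint is put in the form [F f <= a] or [F f = a] with [F] continuous, hence the factors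
   [-1]. *)
rewrite (_ : [set _ | _] =
  \bigcap_e [set f | -1 * W f e <= 0] `&` [set f | \sum_e W f e = 1] `&`
  \bigcap_e [set f | -1 * M f e <= 0] `&`
  \bigcap_i [set f | \sum_e c i e * M f e = b i] `&`
  \bigcap_(p : E -> R)
    [set f | \sum_e (p e * M f e - h e (p e) * W f e) - A f <= 0]).
  have cW e : continuous (W ^~ e) by exact: ev_continuous.
  have cM e : continuous (M ^~ e) by exact: ev_continuous.
  have cA : continuous A by exact: ev_continuous.
  do 4?apply: closedI; try apply: closed_bigI => ? _;
    apply: closed_cst_le || apply: closed_cst_eq.
  - exact: continuous_scale.
  - exact: sum_continuous.
  - exact: continuous_scale.
  - by apply: sum_continuous => e; exact: continuous_scale.
  - apply: continuous_sub => //; apply: sum_continuous => e.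
    by apply: continuous_sub; exact: continuous_scale.
apply/seteqP; split=> f /=.
  move=> [w0 w1 m0 cm ha]; split; first split; first split; first split => //.
  - by move=> e _ /=; rewrite mulN1r oppr_le0.
  - by move=> e _ /=; rewrite mulN1r oppr_le0.
  - by move=> i _; exact: cm.
  - by move=> p _ /=; rewrite subr_le0.
move=> [[[[w0 w1] m0] cm] ha]; split => //.
- by move=> e; rewrite -oppr_le0 -mulN1r; exact: w0.
- by move=> e; rewrite -oppr_le0 -mulN1r; exact: m0.
- by move=> i; exact: cm.
- by move=> p; rewrite -subr_le0; exact: ha.
Qed.

Let H1 p := \sum_e `|h e p|.

(** Constant slope [p]; as each mass lies in [[0, 1]], the term in [h] is at most [H1 p]. *)
Let feasible_cost (w m : E -> R) (a : R) p : feasible w m a ->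
  p * \sum_e m e <= a + H1 p.
Proof.
move=> [w0 w1 m0 _ /(_ (fun=> p))].
rewrite sumrB -mulr_sumr lerBlDr => /le_trans; apply; rewrite lerD2l.
apply: ler_sum => e _; rewrite (le_trans (ler_norm _))// normrM (ger0_norm (w0 e)).
by rewrite ler_piMr// -w1 (bigD1 e)//= lerDl sumr_ge0.
Qed.

Lemma feasible_min : (exists w m a, feasible w m a) ->
  exists w m a, feasible w m a /\
    forall w' m' a', feasible w' m' a' -> a <= a'.
Proof.
move=> [w [m [a0 F0]]].
pose K := [set f : X | feasible (W f) (M f) (A f)] `&` [set f | A f <= a0].
pose mk (w m : E -> R) (a : R) : X := fun i =>
  match i with None => a | Some (inl e) => w e | Some (inr e) => m e end.
have mkK w' m' a' : feasible w' m' a' -> a' <= a0 -> K (mk w' m' a').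
  by move=> F' aa; split.
(* By [feasible_cost], slope [0] bounds [a] from below and slope [1] bounds the total moment. *)
pose box (i : option (E + E)) : set R := match i with
  | None => [set` `[- H1 0, a0]] | Some (inl _) => [set` `[0, 1]]
  | Some (inr _) => [set` `[0, a0 + H1 1]] end.
have Kcompact : compact K.
  apply: (@subclosed_compact _ _ [set f : X | forall i, box i (f i)]).
  - apply: closedI => //; apply: closed_cst_le; exact: ev_continuous.
  - apply: (@tychonoff _ (fun=> R)) => -[[e|e]|]; exact: segment_compact.
  - move=> f [Ff Aa] [[e|e]|] /=; have [w0 w1 m0 _ _] := Ff; rewrite in_itv /=.
    + by rewrite w0 -w1 (bigD1 e)//= lerDl sumr_ge0.
    + rewrite m0 /=; have := feasible_cost 1 Ff; rewrite mul1r => mle.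
      rewrite (le_trans _ (le_trans mle _)) ?lerD2r//.
      by rewrite (bigD1 e)//= lerDl sumr_ge0.
    + by have := feasible_cost 0 Ff; rewrite mul0r Aa andbT -lerBlDr sub0r.
have K0 : K !=set0 by exists (mk w m a0); exact: mkK.
have cA : {within K, continuous A}.
  by apply: continuous_subspaceT; exact: ev_continuous.
have [f /set_mem[Ff fa] fmin] := compact_EVT_min K0 Kcompact cA.
exists (W f), (M f), (A f); split => // w' m' a' F'.
have [a'a|/ltW] := leP a' a0; last exact: le_trans.
by apply: (fmin (mk w' m' a')); exact/mem_set/mkK.
Qed.

End finite_dimensional_minimum.

(** * Minimal measures under linear constraints *)

(** On a massless edge a steep slope costs nothing, so a positive moment there would make the lower
    bounds on [a] unbounded. *)
Lemma feasible_mass0 (R : realType) (E : finType) (I : Type) (h : E -> R -> R)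
    (c : I -> E -> R) b w m a e :
  feasible h c b w m a -> w e = 0 -> m e = 0.
Proof.
move=> [_ _ m0 _ ha] we; apply/eqP/negP => /negP me.
(* Slope [t] on [e] and [0] elsewhere turns the inequality into [a + 1 <= a]. *)
pose t := (a + \sum_(e' | e' != e) h e' 0 * w e' + 1) / m e.
have := ha (fun e' => if e' == e then t else 0).
rewrite (bigD1 e) //= eqxx we mulr0 subr0 mulfVK //.
under eq_bigr => e' /negbTE -> do rewrite mul0r sub0r.
by rewrite sumrN; lra.
Qed.

Section linear_constraints.
Variables (R : realType) (G : graph) (H : edge G -> R -> R).
Hypothesis hH : is_hamiltonian H.
Variables (I : Type) (c : I -> edge G -> R) (b : I -> R).

Lemma feasible_lagrangian (w m : edge G -> R) :
  (forall e, 0 <= w e) -> \sum_e w e = 1 -> (forall e, 0 <= m e) ->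
  (forall i, \sum_e c i e * m e = b i) -> (forall e, w e = 0 -> m e = 0) ->
  feasible H c b w m (\sum_e w e * lagrangian H e (m e / w e)).
Proof.
move=> w0 w1 m0 cm wm; split => // p; apply: ler_sum => e _.
have [we|we] := eqVneq (w e) 0; first by rewrite wm // we !mulr0 mul0r subr0.
have -> : m e = w e * (m e / w e) by rewrite mulrCA divff ?mulr1.
rewrite mulrCA [H _ _ * _]mulrC -mulrBr ler_wpM2l // mulrAC divff // mul1r.
by have [_ _] := lagrangian_max e (m e / w e) hH; exact.
Qed.

(** The slope attaining the maximum at speed [m e / w e] makes Young's inequality an equality on
    each edge; massless edges contribute [0] to both sides. *)
Lemma feasible_ge (w m : edge G -> R) a : feasible H c b w m a ->
  \sum_e w e * lagrangian H e (m e / w e) <= a.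
Proof.
move=> F; have [w0 w1 m0 cm ha] := F.
have /choice[p hp] e :
    exists p, lagrangian H e (m e / w e) = p * (m e / w e) - H e p.
  by have [p -> _] := lagrangian_max e (m e / w e) hH; exists p.
apply: le_trans (ha p); apply: ler_sum => e _; rewrite hp.
have [we|we] := eqVneq (w e) 0.
  by rewrite (feasible_mass0 F we) we !mul0r !mulr0 subr0.
by rewrite mulrBr [w e * H _ _]mulrC mulrCA [w e * _]mulrCA divff // mulr1.
Qed.

Lemma feasible_measure (mu : tangent_measure R G) a : finite_first_moment mu ->
  (forall i, \sum_e c i e * ray_moment mu e = b i) -> action H mu = a%:E ->
  feasible H c b (edge_mass mu) (ray_moment mu) a.
Proof.
move=> fm cm mua; split => // [e||e|p].
- exact: edge_mass_ge0.
- exact: sum_edge_mass.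
- exact: ray_moment_ge0.
- by rewrite -lee_fin -mua; exact: action_ge.
Qed.

Lemma action_min_linear :
  (exists m : edge G -> R,
    (forall e, 0 <= m e) /\ forall i, \sum_e c i e * m e = b i) ->
  admits_min (action H) [set mu : tangent_measure R G |
    finite_first_moment mu /\ forall i, \sum_e c i e * ray_moment mu e = b i].
Proof.
move=> [m0 [m0_ge0 cm0]].
have [|w [m [a [F amin]]]] := @feasible_min R (edge G) I H c b.
  (* Uniform masses are positive on every edge, so any admissible moments extend to a feasible
     triple. *)
  pose N : R := #|edge G|%:R; have N0 : N != 0.
    by rewrite pnatr_eq0 -lt0n edge_nonempty.
  exists (fun=> N^-1), m0; eexists; apply: feasible_lagrangian => //.
  - by move=> e; rewrite invr_ge0 ler0n.
  - by rewrite sumr_const -[_ *+ _]mulr_natl divff.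
  - by move=> e /eqP; rewrite invr_eq0 (negbTE N0).
have [w0 w1 m_ge0 cm _] := F.
have [mu [mu_fin mum mua]] :=
  atomic_tangent hH w0 w1 m_ge0 (fun e => @feasible_mass0 _ _ _ _ _ _ _ _ _ e F).
exists mu => [|nu [nu_fin cnu]].
  by split => // i; rewrite -cm; apply: eq_bigr => e _; rewrite mum.
rewrite mua; case nua : (action H nu) => [r| |].
- rewrite lee_fin (le_trans (feasible_ge F)) //.
  exact: amin (feasible_measure nu_fin cnu nua).
- by rewrite leey.
(* The zero slope gives a finite lower bound, which excludes [-oo]. *)
- by have := action_ge nu_fin (fun=> 0) hH; rewrite nua leeNy_eq.
Qed.

End linear_constraints.

(** * Rotation vectors as linear constraints on the moments *)

Section rotation_coordinates.
Variables (R : realType) (G : graph).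
Implicit Types x : {ffun edge G -> R^o}.

Lemma edge_relationsP x :
  x \in edge_relations R G <-> forall e, x e = x (Defs.opp e).
Proof.
split=> [/(@coord_span _ _ _ (in_tuple _)) -> e|xs].
  rewrite !sum_ffunE; apply: eq_bigr => i _; rewrite !ffunE; congr (_ *: _).
  have /mapP[e' _ ->] := mem_nth 0 (ltn_ord i).
  rewrite !ffunE (inj_eq (can_inj (@opp_involutive G))) addrC.
  by rewrite [e == _]eq_opp [e' == _]eq_sym.
(* The factor one half appears because [e] and [opp e] yield the same generator. *)
have -> : x = \sum_(e in edge G) (x e / 2) *: (delta1 R e + delta1 R (Defs.opp e)).
  apply/ffunP => e; rewrite sum_ffunE; under eq_bigr do rewrite !ffunE /=.
  rewrite (bigD1 e) //= (bigD1 (Defs.opp e)) ?opp_neq //=.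
  rewrite big1 => [|e' /andP[ne ne']].
    rewrite opp_involutive !eqxx -xs ![e == Defs.opp e]eq_sym (negbTE (opp_neq _)).
    by rewrite /GRing.scale /=; lra.
  rewrite [e == e']eq_sym (negbTE ne) [e == _]eq_opp (negbTE ne').
  by rewrite addr0 scaler0.
apply: memv_suml => e _; apply/memvZ/memv_span/mapP; exists e => //.
by rewrite mem_enum.
Qed.

Lemma rotation_pi (mu : tangent_measure R G) :
  rotation mu = \pi_(chain1 R G) [ffun e => ray_moment mu e].
Proof.
have -> : [ffun e => ray_moment mu e] =
    \sum_e ray_moment mu e *: delta1 R e :> {ffun edge G -> R^o}.
  apply/ffunP => e; rewrite sum_ffunE ffunE (bigD1 e) //= big1 => [|e' ne].
    by rewrite !ffunE eqxx addr0 [RHS]mulr1.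
  by rewrite !ffunE eq_sym (negbTE ne) scaler0.
have pi0 : \pi_(chain1 R G) 0 = 0 by exact: pi_zeror.
by rewrite (big_morph _ (@pi_chain1D R G) pi0);
  apply: eq_bigr => e _; rewrite pi_chain1Z.
Qed.

(** The relations are the functions symmetric under [opp], so a class in the quotient is determined
    by its antisymmetric part. *)
Lemma rotationP (mu : tangent_measure R G) (h : chain1 R G) :
  rotation mu = h <-> forall e,
    ray_moment mu e - ray_moment mu (Defs.opp e) =
    repr h e - repr h (Defs.opp e).
Proof.
rewrite -{1}(reprK h) rotation_pi chain1_eqP edge_relationsP.
by split=> hr e; have := hr e; rewrite !ffunE; lra.
Qed.

End rotation_coordinates.

Theorem theorem5p3 (R : realType) (G : graph) (H : edge G -> R -> R) :
  connected_graph G -> loopless G -> is_hamiltonian H ->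
  admits_min (action H) (@closed_measures R G) /\
  (forall h : chain1 R G, homology1 h ->
    admits_min (action H)
      [set mu : tangent_measure R G | closed_measures mu /\ rotation mu = h]).
Proof.
move=> _ _ hH; split=> [|h h_closed].
  (* Closedness is one linear equation on the moments for each [f], and zero moments satisfy them
     all. *)
  apply: (@action_min_linear R G H hH _ (@differential R G) (fun=> 0)).
  by exists (fun=> 0); split=> // f; rewrite big1 // => e _; rewrite mulr0.
pose c (e e' : edge G) : R := (e' == e)%:R - (e' == Defs.opp e)%:R.
pose b e : R := repr h e - repr h (Defs.opp e).
have cE (m : edge G -> R) e : \sum_e' c e e' * m e' = m e - m (Defs.opp e).
  under eq_bigr do rewrite mulrBl.
  have sumE e0 : \sum_e' (e' == e0)%:R * m e' = m e0.
    rewrite (bigD1 e0) //= eqxx mul1r big1 ?addr0 // => e' /negbTE ->.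
    by rewrite mul0r.
  by rewrite sumrB !sumE.
rewrite (_ : [set _ | _] = [set mu : tangent_measure R G |
    finite_first_moment mu /\ forall e, \sum_e' c e e' * ray_moment mu e' = b e]).
  (* Since [b (opp e) = - b e], the positive part of [b] is a nonnegative solution: [b e] is its
     positive part minus its negative part. *)
  apply: action_min_linear => //; exists (fun e => Num.max 0 (b e)); split=> e.
    by rewrite le_max lexx.
  have -> : b e = Num.max 0 (b e) - Num.max 0 (- b e)
    by case: (leP 0 (b e)) => ?; case: (leP 0 (- b e)) => ?; lra.
  by rewrite cE [- b e]opprB /b opp_involutive.
apply/seteqP; split=> mu /=.
  move=> [[mu_fin _] /rotationP rho]; split=> // e.
  by rewrite cE rho.
(* Closedness comes for free from the rotation vector, as [h] is a cycle. *)
move=> [mu_fin rho]; have rho_h : rotation mu = h.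
  by apply/rotationP => e; rewrite -cE.
by split=> //; rewrite closed_measuresE; split => //=; rewrite rho_h.
Qed.
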